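(* Let $n\in\mathbb N$ be finite, $\mathcal D\subseteq\mathbb R^n$ nonempty, $T\ge1$, $s_1,\dots,s_T\in\mathbb R^n$, $q\in\mathbb R^n$, and $\eta_1\ge\eta_2\ge\dots\ge\eta_T>0$; put $\frac1{\eta_0}:=0$. Assume that the required extrema over $\mathcal D$ exist, i.e. that $d\mapsto d\circ v$ attains its minimum over $\mathcal D$ for $v=s_{<t}$, $v=s_{<t}-q/\eta_t$ and $v=s_{1:t}-q/\eta_t$ ($1\le t\le T$) and $v=s_{1:T}$, and that $d\mapsto d\circ q$ attains its maximum over $\mathcal D$. Then $$\sum_{t=1}^T M\Big(s_{<t}-\frac{q}{\eta_t}\Big)\circ s_t\;\ge\;\min_{d\in\mathcal D}\{d\circ s_{1:T}\}-\frac1{\eta_T}\max_{d\in\mathcal D}\{d\circ q\}+\sum_{t=1}^T\Big(\frac1{\eta_t}-\frac1{\eta_{t-1}}\Big)M(s_{<t})\circ q .$$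
   Context: $\circ$ denotes the standard inner product on $\mathbb R^n$. $s_{1:t}=s_1+\dots+s_t$ and $s_{<t}=s_1+\dots+s_{t-1}$ (so $s_{<1}=0$). For a vector $s$, $M(s)\in\arg\min_{d\in\mathcal D}\{d\circ s\}$ denotes a (fixed, arbitrarily chosen) minimizer over $\mathcal D$ of $d\mapsto d\circ s$. *)

(* Defs.v *)
From mathcomp Require Import all_boot all_order all_algebra.
From mathcomp Require Import all_classical all_reals.
Set Implicit Arguments.
Unset Strict Implicit.
Unset Printing Implicit Defensive.
Import Order.TTheory GRing.Theory Num.Theory.
Local Open Scope classical_set_scope.
Local Open Scope ring_scope.

Definition dot (R : realType) (n : nat) (u v : 'rV[R]_n) : R :=
  \sum_(i < n) u ord0 i * v ord0 i.

Definition argmin (R : realType) (n : nat) (D : set 'rV[R]_n) (v : 'rV[R]_n)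
    : set 'rV[R]_n :=
  [set d | D d /\ forall d', D d' -> dot d v <= dot d' v].

Definition argmax (R : realType) (n : nat) (D : set 'rV[R]_n) (v : 'rV[R]_n)
    : set 'rV[R]_n :=
  [set d | D d /\ forall d', D d' -> dot d' v <= dot d v].

(* The values min_{d in D} dot d v and max_{d in D} dot d v.  [inf] and [sup]
   are total, so these are meaningful only when the extremum is attained; see
   [min_dotE] and [max_dotE]. *)
Definition min_dot (R : realType) (n : nat) (D : set 'rV[R]_n) (v : 'rV[R]_n)
    : R := inf [set dot d v | d in D].

Definition max_dot (R : realType) (n : nat) (D : set 'rV[R]_n) (v : 'rV[R]_n)
    : R := sup [set dot d v | d in D].

Lemma min_dotE (R : realType) (n : nat) (D : set 'rV[R]_n) (v d : 'rV[R]_n) :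
  argmin D v d -> min_dot D v = dot d v.
Proof.
move=> [Dd dmin]; have lb : lbound [set dot d v | d in D] (dot d v).
  by move=> _ [d' Dd' <-]; exact: dmin.
apply/eqP; rewrite eq_le; apply/andP; split.
  by apply: ge_inf; [exists (dot d v) | exists d].
by apply: lb_le_inf => //; exists (dot d v), d.
Qed.

Lemma max_dotE (R : realType) (n : nat) (D : set 'rV[R]_n) (v d : 'rV[R]_n) :
  argmax D v d -> max_dot D v = dot d v.
Proof.
move=> [Dd dmax]; have ub : ubound [set dot d v | d in D] (dot d v).
  by move=> _ [d' Dd' <-]; exact: dmax.
apply/eqP; rewrite eq_le; apply/andP; split.
  by apply: ge_sup => //; exists (dot d v), d.
by apply: ub_le_sup; [exists (dot d v) | exists d].
Qed.

(* A fixed choice of minimizers, constrained only where a minimizer exists. *)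
Definition selects_argmin (R : realType) (n : nat) (D : set 'rV[R]_n)
    (M : 'rV[R]_n -> 'rV[R]_n) : Prop :=
  forall v, argmin D v !=set0 -> argmin D v (M v).

(* Sequences are indexed from 1: sum_upto s t = s_1 + ... + s_t and
   sum_before s t = s_1 + ... + s_(t-1). *)
Definition sum_upto (R : realType) (n : nat) (s : nat -> 'rV[R]_n) (t : nat)
    : 'rV[R]_n := \sum_(1 <= i < t.+1) s i.

Definition sum_before (R : realType) (n : nat) (s : nat -> 'rV[R]_n) (t : nat)
    : 'rV[R]_n := \sum_(1 <= i < t) s i.

(* 1 / eta_t, with the convention 1 / eta_0 := 0 whatever the value eta 0. *)
Definition inv_rate (R : realType) (eta : nat -> R) (t : nat) : R :=
  if t is 0%N then 0 else (eta t)^-1.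

(* Main.v *)
(* Write F v for the minimum of d o v over D and a_t for 1/eta_t.  Testing the
   minimum defining F (s_{1:t} - a_t q) on x_t := M (s_{<t} - a_t q) gives
     x_t o s_t >= F (s_{1:t} - a_t q) - F (s_{<t} - a_t q),
   and F (s_{<t} - a_t q) is at most
   F (s_{<t} - a_{t-1} q) - (a_t - a_{t-1}) M (s_{<t}) o q, because for a > 0 a
   minimizer of d o (v - a q) has no smaller inner product with q than a
   minimizer of d o v (and for a = 0 one tests on M v itself).  The sum over t
   telescopes, and F (s_{1:T} - a_T q) >= F s_{1:T} - a_T max (d o q). *)

Require Import Defs.
From mathcomp Require Import all_boot all_order all_algebra.
From mathcomp Require Import all_classical all_reals.
From mathcomp Require Import lra.
Import Order.TTheory GRing.Theory Num.Theory.
Local Open Scope classical_set_scope.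
Local Open Scope ring_scope.

Lemma dotDr (R : realType) (n : nat) (d u v : 'rV[R]_n) :
  dot d (u + v) = dot d u + dot d v.
Proof.
by rewrite /dot -big_split; apply: eq_bigr => i _; rewrite mxE mulrDr.
Qed.

Lemma dotZr (R : realType) (n : nat) (d v : 'rV[R]_n) (c : R) :
  dot d (c *: v) = c * dot d v.
Proof.
by rewrite /dot mulr_sumr; apply: eq_bigr => i _; rewrite mxE mulrCA.
Qed.

Lemma dot0r (R : realType) (n : nat) (d : 'rV[R]_n) : dot d 0 = 0.
Proof. by rewrite /dot big1 // => i _; rewrite mxE mulr0. Qed.

Lemma dotBZr (R : realType) (n : nat) (d u v : 'rV[R]_n) (c : R) :
  dot d (u - c *: v) = dot d u - c * dot d v.
Proof. by rewrite -scaleNr dotDr dotZr mulNr. Qed.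

(** Adding the optimality of [m] tested on [x] to that of [x] tested on [m] gives
    [a * dot m q <= a * dot x q]. After cancelling [a > 0], testing [y] on [x] concludes; for
    [a = 0], [y] is tested on [m]. *)
Lemma argmin_perturb_le (R : realType) (n : nat) (D : set 'rV[R]_n)
    (v q m x y : 'rV[R]_n) (a b : R) :
  0 <= a -> a <= b -> argmin D v m ->
  argmin D (v - a *: q) x -> argmin D (v - b *: q) y ->
  dot y (v - b *: q) <= dot x (v - a *: q) - (b - a) * dot m q.
Proof.
move=> a_ge0 le_ab [Dm m_min] [Dx x_min] [Dy y_min].
have := y_min _ Dm; have := y_min _ Dx; have := x_min _ Dm; have := m_min _ Dx.
rewrite !dotBZr => mx xm yx ym.
move: a_ge0; rewrite le_eqVlt => /orP[/eqP a0|a_gt0].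
  by rewrite -a0 in xm yx *; lra.
have mqx : dot m q <= dot x q by rewrite -(ler_pM2l a_gt0); lra.
suff : (b - a) * dot m q <= (b - a) * dot x q by lra.
by rewrite ler_wpM2l ?subr_ge0.
Qed.
Arguments argmin_perturb_le {R n D v q m x y a b}.

Theorem theorem10 (R : realType) (n : nat) (D : set 'rV[R]_n)
    (M : 'rV[R]_n -> 'rV[R]_n)
    (T : nat) (s : nat -> 'rV[R]_n) (q : 'rV[R]_n) (eta : nat -> R)
    (D_neq0 : D !=set0)
    (M_argmin : selects_argmin D M)
    (T_ge1 : (1 <= T)%N)
    (eta_noninc : forall t : nat, (1 <= t < T)%N -> eta t.+1 <= eta t)
    (eta_gt0 : 0 < eta T)
    (min_before : forall t : nat, (1 <= t <= T)%N ->
      argmin D (sum_before s t) !=set0)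
    (min_before_pert : forall t : nat, (1 <= t <= T)%N ->
      argmin D (sum_before s t - (eta t)^-1 *: q) !=set0)
    (min_upto_pert : forall t : nat, (1 <= t <= T)%N ->
      argmin D (sum_upto s t - (eta t)^-1 *: q) !=set0)
    (min_total : argmin D (sum_upto s T) !=set0)
    (max_q : argmax D q !=set0) :
  \sum_(1 <= t < T.+1) dot (M (sum_before s t - (eta t)^-1 *: q)) (s t)
  >= min_dot D (sum_upto s T) - (eta T)^-1 * max_dot D q
     + \sum_(1 <= t < T.+1)
         (inv_rate eta t - inv_rate eta t.-1) * dot (M (sum_before s t)) q.
Proof.
have eta_pos t : (1 <= t <= T)%N -> 0 < eta t.
  (* Positivity propagates downwards from [eta T], by induction on [T - t]. *)
  move=> /andP[t_ge1 tT]; rewrite -(subKn tT).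
  have: (T - t < T)%N by rewrite ltn_subrL t_ge1.
  elim: (T - t)%N => [|k IHk] kT; first by rewrite subn0.
  apply: lt_le_trans (IHk (ltnW kT)) _.
  have -> : (T - k = (T - k.+1).+1)%N by rewrite subnSK // ltnW.
  by apply: eta_noninc; rewrite subn_gt0 kT ltn_subrL.
have telescope k : (k <= T)%N ->
  let v := sum_upto s k - inv_rate eta k *: q in
  dot (M v) v + \sum_(1 <= t < k.+1)
      (inv_rate eta t - inv_rate eta t.-1) * dot (M (sum_before s t)) q
  <= \sum_(1 <= t < k.+1) dot (M (sum_before s t - (eta t)^-1 *: q)) (s t).
  elim: k => [|k IHk] kT /=.
    (* As [inv_rate eta 0 = 0], the vector is 0 and both sides vanish. *)
    by rewrite /sum_upto !big_geq // scale0r subr0 dot0r addr0.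
  have /= := IHk (ltnW kT).
  rewrite !(big_nat_recr k.+1) //=.
  set G := \sum_(1 <= t < k.+1) _; set L := \sum_(1 <= t < k.+1) _.
  have k1T : (1 <= k.+1 <= T)%N by [].
  have hm := M_argmin _ (min_before _ k1T).
  have hy := M_argmin _ (min_before_pert _ k1T).
  have [_ z_min] := M_argmin _ (min_upto_pert _ k1T).
  have hx : argmin D (sum_upto s k - inv_rate eta k *: q)
              (M (sum_upto s k - inv_rate eta k *: q)).
    (* For [k = 0] the perturbation is zero and the vector is [sum_before s 1], so [hm] applies. *)
    case: (k) kT hm => [|j] jT hm; first by rewrite /= scale0r subr0.
    by apply/M_argmin/min_upto_pert; rewrite /= ltnW.
  have a_ge0 : 0 <= inv_rate eta k.
    by case: (k) kT => // j jT; rewrite /= invr_ge0 ltW ?eta_pos //= ltnW.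
  have le_ab : inv_rate eta k <= (eta k.+1)^-1.
    case: (k) kT k1T => [|j] jT j1T; first by rewrite /= invr_ge0 ltW ?eta_pos.
    by rewrite /= lef_pV2 ?posrE ?eta_pos ?eta_noninc //= ltnW.
  have := argmin_perturb_le a_ge0 le_ab hm hx hy.
  have := z_min _ hy.1.
  have -> : sum_upto s k.+1 = sum_before s k.+1 + s k.+1.
    by rewrite /sum_upto /sum_before big_nat_recr.
  (* Isolates [s k.+1]: the new summand on the right splits off, leaving the value at [hy] that the
     perturbation bound controls. *)
  rewrite [X in _ <= dot _ X -> _]addrAC [X in _ <= X -> _]dotDr.
  rewrite -/(sum_before s k.+1); lra.
have := telescope T (leqnn T).
have -> : inv_rate eta T = (eta T)^-1 by case: (T) T_ge1.
have T1T : (1 <= T <= T)%N by rewrite T_ge1 leqnn.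
have [Dz _] := M_argmin _ (min_upto_pert _ T1T).
have [x x_min] := min_total; have [y y_max] := max_q.
rewrite /= (min_dotE x_min) (max_dotE y_max).
(* The sums cancel; the last perturbed minimizer, a point of [D], is compared with [x] and [y]
   termwise. *)
apply: le_trans; rewrite lerD2r dotBZr lerB ?x_min.2 //.
by rewrite ler_wpM2l ?y_max.2 // invr_ge0 ltW.
Qed.
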